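(* Let $(E,\lambda)$ be a connectivity system and $k\in\mathbb{N}$. For every $k$-anemone $\Phi$ of $(E,\lambda)$ with at least $k+1$ many petals there is a strong $k$-pseudoanemone $\Psi$ such that $\Phi\leq_A\Psi$ and such that for all $k$-pseudoflowers $\Psi'$: if $\Phi\leq\Psi'$ then $\Psi'\leq_A\Psi$.
   Context: $\mathbb{N}$ contains $0$; expressions such as $k-1$ are taken in $\mathbb{Z}$. A connectivity system is a (possibly infinite) set $E$ with a map $\lambda:2^E\to\mathbb{N}\cup\{\infty\}$ such that for all $A,B\subseteq E$: $\lambda(A)=\lambda(E\setminus A)$, $\lambda(A)+\lambda(B)\geq\lambda(A\cup B)+\lambda(A\cap B)$, and $\lambda$ is limit-closed: if $n\in\mathbb{N}$ and $(A_i)_{i\in I}$ is a (non-empty) chain with respect to inclusion of subsets of $E$ with $\lambda(A_i)\le n$ for all $i$, then $\lambda(\bigcup_{i}A_i)\leq n$. The value $\lambda(A)$ is called the order (or connectivity) of $A$. A cyclic order on a set $I$ is a total strict cyclic order; $]x,y[$ is the set of elements strictly between $x$ and $y$ when going from $x$ to $y$. An interval of $I$ is a subset $Y\subseteq I$ such that for all distinct $x,z\in Y$ at least one of $]x,z[$ and $]z,x[$ is contained in $Y$; it is non-trivial if $Y\notin\{\emptyset,I\}$. A $k$-pseudoflower is a partition $(P_i)_{i\in I}$ of $E$ (into non-empty classes, called petals) with a cyclically ordered index set $I$ such that the union of any interval of partition classes has order at most $k-1$. A concatenation of a $k$-pseudoflower $(P_i)_{i\in I}$ is a $k$-pseudoflower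 $(Q_i)_{i\in I'}$ such that for every $i\in I$ there is $f(i)\in I'$ with $P_i\subseteq Q_{f(i)}$, and such that for all intervals $I''$ of $I'$ the set $f^{-1}(I'')$ is an interval of $I$. If $\Phi$ is a concatenation of $\Psi$ one writes $\Phi\leq\Psi$. A $k$-flower is a $k$-pseudoflower with at least four petals in which the union of any non-trivial interval of petals has order exactly $k-1$. A $k$-anemone is a $k$-flower such that all non-trivial unions of petals (unions of a non-empty, proper subset of the petals) of finite concatenations (concatenations with finitely many petals) have order $k-1$. A strong $k$-pseudoanemone is a $k$-pseudoflower for which all unions of petals have order at most $k-1$. Write $\Phi\leq_A\Psi$ if the partition of $\Phi$ is coarser than (or equal to) the partition of $\Psi$, i.e. every petal of $\Psi$ is contained in a petal of $\Phi$, irrespective of the cyclic orders. *)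

(* Defs.v *)
From mathcomp Require Import all_boot all_order all_algebra.
From mathcomp Require Import boolp classical_sets functions cardinality.
From mathcomp Require Import constructive_ereal.
Set Implicit Arguments.
Unset Strict Implicit.
Unset Printing Implicit Defensive.
Import Order.TTheory GRing.Theory Num.Theory.
Local Open Scope classical_set_scope.
Local Open Scope ring_scope.

(* The values of [conn] lie in N ∪ {oo}: they are extended integers, and
   [conn_ge0] excludes -oo and the negative integers. *)
Record connectivity_system := ConnectivitySystem {
  ground :> Type;
  conn : set ground -> \bar int;
  conn_ge0 : forall A, (0 <= conn A)%E;
  conn_setC : forall A, conn A = conn (~` A);
  conn_submod : forall A B,
    (conn (A `|` B) + conn (A `&` B) <= conn A + conn B)%E;
  conn_limit_closed : forall (n : nat) (C : set (set ground)),
    C !=set0 -> total_on C (@subset ground) ->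
    (forall A, C A -> (conn A <= n%:Z%:E)%E) ->
    (conn (\bigcup_(A in C) A) <= n%:Z%:E)%E }.

(* [R x y z] reads: going from [x] to [z] one passes [y]. *)
Record cyclic_order (I : Type) (R : I -> I -> I -> Prop) : Prop := CyclicOrder {
  cyc_rot : forall x y z, R x y z -> R y z x;
  cyc_asym : forall x y z, R x y z -> ~ R z y x;
  cyc_trans : forall x y z w, R x y z -> R x z w -> R x y w;
  cyc_total : forall x y z, x <> y -> y <> z -> z <> x -> R x y z \/ R z y x }.

Definition strictly_between (I : Type) (R : I -> I -> I -> Prop) (x y : I) :
  set I := [set z | R x z y].

Definition cyc_interval (I : Type) (R : I -> I -> I -> Prop) (Y : set I) : Prop :=
  forall x z, Y x -> Y z -> x <> z ->
    strictly_between R x z `<=` Y \/ strictly_between R z x `<=` Y.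

Definition nontrivial (I : Type) (Y : set I) : Prop := Y <> set0 /\ Y <> setT.

(* [k%:Z - 1] is the integer difference, so it is -1 when [k] is 0. *)
Record pseudoflower (E : connectivity_system) (k : nat) := Pseudoflower {
  petal_index : Type;
  cyc : petal_index -> petal_index -> petal_index -> Prop;
  petal : petal_index -> set E;
  cyc_order : cyclic_order cyc;
  petal_partition : partition setT petal setT;
  petal_interval : forall Y, cyc_interval cyc Y ->
    (conn (\bigcup_(i in Y) petal i) <= (k%:Z - 1)%:E)%E }.

Section Flowers.
Variables (E : connectivity_system) (k : nat).
Implicit Types Phi Psi : pseudoflower E k.

Definition petals_union Phi (Y : set (petal_index Phi)) : set E :=
  \bigcup_(i in Y) petal i.

Definition at_least_petals (n : nat) Phi : Prop :=
  (`I_n #<= [set: petal_index Phi])%card.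

Definition finitely_many_petals Phi : Prop := finite_set [set: petal_index Phi].

(* [concatenation Phi Psi]: Phi is a concatenation of Psi, i.e. Phi <= Psi. *)
Definition concatenation Phi Psi : Prop :=
  exists f : petal_index Psi -> petal_index Phi,
    (forall i, petal i `<=` petal (f i)) /\
    (forall Y, cyc_interval (@cyc _ _ Phi) Y -> cyc_interval (@cyc _ _ Psi) (f @^-1` Y)).

Definition flower Phi : Prop :=
  at_least_petals 4 Phi /\
  forall Y, cyc_interval (@cyc _ _ Phi) Y -> nontrivial Y ->
    conn (petals_union Y) = (k%:Z - 1)%:E.

Definition anemone Phi : Prop :=
  flower Phi /\
  forall Phi', concatenation Phi' Phi -> finitely_many_petals Phi' ->
    forall Y : set (petal_index Phi'), nontrivial Y ->
      conn (petals_union Y) = (k%:Z - 1)%:E.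

Definition strong_pseudoanemone Phi : Prop :=
  forall Y : set (petal_index Phi), (conn (petals_union Y) <= (k%:Z - 1)%:E)%E.

(* The relation Phi <=_A Psi. *)
Definition leA Phi Psi : Prop :=
  forall j : petal_index Psi, exists i : petal_index Phi, petal j `<=` petal i.

End Flowers.

(* Main.v *)
Require Import Defs.
From mathcomp Require Import all_boot all_order all_algebra.
From mathcomp Require Import boolp classical_sets functions cardinality wochoice.
From mathcomp Require Import constructive_ereal.
From mathcomp Require Import zify.

Set Implicit Arguments.
Unset Strict Implicit.
Unset Printing Implicit Defensive.
Import Order.TTheory GRing.Theory Num.Theory.
Local Open Scope classical_set_scope.
Local Open Scope ring_scope.

(** Write [m] for k - 1.  Group the petals of the anemone into [n] consecutive
    blocks, [n] being the larger of 4 and k + 1; the resulting finite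
    concatenation is recorded as a colouring [c] of the ground set by ['I_n].
    Since the flower is an anemone, every non-trivial union of colour classes
    has order exactly [m] ([anemone_colouring]).

    Call a set [A] good if, for each colour class P and each union Q of other
    classes, (A `&` P) `|` Q has order at most [m].  Uncrossing against the
    unions of classes, whose order is known exactly, shows two things when
    there are at least four classes.  For a subset X of P, it suffices that
    X `|` Q has order at most [m] for one single class Q
    ([subpetal_spread]); and the order of X `|` Q is never below [m]
    ([subpetal_lower]).  The first makes goodness easy to verify, the second
    makes good sets closed under unions.  Complements are immediate, and limit
    closure with Zorn's lemma gives arbitrary unions: the good sets form a
    complete field of sets.

    A good set has order at most [m] ([good_conn]).  This is where the number
    of classes matters: if the order of A exceeded [m], the traces of A on the
    first s classes, for s < n, would have strictly increasing orders; the
    last of them is at most k - 1, and n > k distinct values do not fit into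
    0, ..., k - 1.

    Each petal q of a pseudoflower that has the anemone as a concatenation is
    good ([petal_good]).  The petals inside one class K form an interval;
    together with a neighbouring class L they form an interval too.  Cutting
    the latter just before and just after q gives two sets of the form
    X `|` L with X inside K, so both sets X are good, and q is their
    difference.

    Hence the atoms of the field of good sets are contained in the petals of
    every such pseudoflower, the anemone itself included, and every union of
    atoms is good, hence of order at most [m].  So in any cyclic order the
    atoms form the required strong pseudoanemone ([atomic_pseudoanemone]). *)

(** * Cyclic orders and linear orders *)

Definition strict_linear (T : Type) (lt : T -> T -> Prop) : Prop :=
  [/\ forall a, ~ lt a a,
      forall a b d, lt a b -> lt b d -> lt a d
    & forall a b, a <> b -> lt a b \/ lt b a].

Definition cyclic_closure (T : Type) (lt : T -> T -> Prop) (a b d : T) : Prop :=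
  [\/ lt a b /\ lt b d, lt b d /\ lt d a | lt d a /\ lt a b].

Section CyclicOrders.
Variable T : Type.

Definition convex (lt : T -> T -> Prop) (Y : set T) : Prop :=
  forall a b z, Y a -> Y b -> lt a z -> lt z b -> Y z.

(** The linear order obtained by cutting a cyclic order open just before [o],
    which becomes the least element. *)
Definition cut (R : T -> T -> T -> Prop) (o a b : T) : Prop :=
  (a = o /\ b <> o) \/ R o a b.

Lemma cyclic_closureP (lt : T -> T -> Prop) :
  strict_linear lt -> cyclic_order (cyclic_closure lt).
Proof.
move=> [irr tr tot]; have {}irr a : lt a a -> False by exact: irr.
split.
- by move=> x y z [[]|[]|[]] *; [apply: Or33|apply: Or31|apply: Or32].
- move=> x y z [[p q]|[p q]|[p q]] [[p' q']|[p' q']|[p' q']];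
    by eauto.
- move=> x y z w [[p q]|[p q]|[p q]] [[p' q']|[p' q']|[p' q']];
    try (by exfalso; eauto);
    by [apply: Or31; eauto|apply: Or32; eauto|apply: Or33; eauto].
- move=> x y z xy yz zx.
  case: (tot _ _ xy) => p; case: (tot _ _ yz) => q; case: (tot _ _ zx) => r;
    by [left; (apply: Or31 + apply: Or32 + apply: Or33); split
       |right; (apply: Or31 + apply: Or32 + apply: Or33); split].
Qed.

Variables (R : T -> T -> T -> Prop) (cR : cyclic_order R).

Lemma cyclic_irr x y : ~ R x y x.
Proof. by move=> h; apply: (cyc_asym cR h). Qed.

Lemma cut_linear o : strict_linear (cut R o).
Proof.
split.
- move=> a [[-> //]|h]; apply: (@cyclic_irr a o).
  exact: (cyc_rot cR (cyc_rot cR h)).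
- move=> a b d [[-> nb]|h] [[eb nd]|h'].
  + by case: nb.
  + left; split=> // ed; subst d; exact: (cyclic_irr h').
  + by subst b; case: (cyclic_irr h).
  + by right; apply: (cyc_trans cR h h').
- move=> a b ab; rewrite /cut.
  have [ao|ao] := pselect (a = o); first by left; left; split=> // bo; apply: ab; rewrite ao bo.
  have [bo|bo] := pselect (b = o); first by right; left.
  have oa : o <> a by move=> e; apply: ao.
  case: (cyc_total cR oa ab bo) => h; first by left; right.
  by right; right; apply: (cyc_rot cR (cyc_rot cR h)).
Qed.

Lemma cut_between o x y z : cut R o x y -> cut R o y z -> R x y z.
Proof.
move=> [[-> ny]|oxy] [[ey nz]|oyz] //.
  by subst y; case: (cyclic_irr oxy).
have yox : R y o x by do 2 apply: (cyc_rot cR).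
by do 2 apply: (cyc_rot cR); exact: (cyc_trans cR (cyc_rot cR oyz) yox).
Qed.

(** With [cut_between], this says that closing up the cut gives back the
    original cyclic order, so that cyclic intervals can be studied as convex
    sets of a linear order. *)
Lemma cyclic_closure_cut o a b d : R a b d -> cyclic_closure (cut R o) a b d.
Proof.
move=> abd; have cC := cyclic_closureP (cut_linear o).
have ab : a <> b.
  by move=> e; subst b; apply: (@cyclic_irr a d); apply: (cyc_rot cR).
have bd : b <> d.
  by move=> e; subst d; apply: (@cyclic_irr b a); do 2 apply: (cyc_rot cR).
have da : d <> a by move=> e; subst d; apply: (cyclic_irr abd).
case: (cyc_total cC ab bd da) => // dba; case: (cyc_asym cR abd).
by case: dba => -[p q]; do ?[exact: (cut_between p q)|apply: (cyc_rot cR)].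
Qed.

Lemma between_cut o a b z : cut R o a b -> R a z b -> cut R o a z /\ cut R o z b.
Proof.
have [irr tr _] := cut_linear o.
move=> ab /(cyclic_closure_cut o)[]// [] p q; case: (irr b).
  by apply: tr q ab.
by apply: tr p ab.
Qed.

Lemma convex_interval o (Y : set T) : convex (cut R o) Y -> cyc_interval R Y.
Proof.
move=> cvx a b Ya Yb ab; have [_ _ tot] := cut_linear o.
by case: (tot _ _ ab) => h; [left|right] => z /(between_cut h)[]; exact: cvx.
Qed.

(** Of the two arcs joining two points of [Y], the one that passes through the
    missing point [o] is not contained in [Y]. *)
Lemma interval_convex o (Y : set T) :
  cyc_interval R Y -> ~ Y o -> convex (cut R o) Y.
Proof.
move=> iY Yo a b z Ya Yb az zb; have [irr tr _] := cut_linear o.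
have ab : a <> b by move=> e; subst b; apply: (irr a); exact: tr az zb.
case: (iY a b Ya Yb ab) => h; first exact/h/(cut_between az zb).
case: Yo; case: (tr _ _ _ az zb) => [[<- //]|oab].
by apply: h; do 2 apply: (cyc_rot cR).
Qed.

(** A map that is monotone after cutting wraps around only once, which is why it
    pulls intervals back to intervals. *)
Lemma interval_preimage o (U : Type) (lt : U -> U -> Prop) (f : T -> U) Y :
  strict_linear lt -> (forall a b, cut R o a b -> f a = f b \/ lt (f a) (f b)) ->
  cyc_interval (cyclic_closure lt) Y -> cyc_interval R (f @^-1` Y).
Proof.
move=> lin mono iY.
have [_ _ tot] := cut_linear o; have [irr tr _] := lin.
have main a b : Y (f a) -> Y (f b) -> cut R o a b ->
    strictly_between R a b `<=` f @^-1` Y \/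
    strictly_between R b a `<=` f @^-1` Y.
  move=> Ya Yb ab; have [eab|nab] := pselect (f a = f b).
    left=> z /(between_cut ab)[az zb] /=.
    case: (mono _ _ az) => [<- //|laz]; case: (mono _ _ zb) => [-> //|lzb].
    by case: (irr (f b)); rewrite -{1}eab; apply: tr laz lzb.
  have lab : lt (f a) (f b) by case: (mono _ _ ab).
  case: (iY _ _ Ya Yb nab) => h; [left|right] => z.
    move=> /(between_cut ab)[az zb] /=.
    case: (mono _ _ az) => [<- //|laz]; case: (mono _ _ zb) => [-> //|lzb].
    by apply: h; apply: Or31.
  have [irrc trc _] := cut_linear o.
  move=> /(cyclic_closure_cut o) [[bz za]|[za _]|[_ bz]] /=.
  - by case: (irrc a); apply: trc ab (trc _ _ _ bz za).
  - case: (mono _ _ za) => [-> //|lza].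
    by apply: h; apply: Or32.
  - case: (mono _ _ bz) => [<- //|lbz].
    by apply: h; apply: Or33.
move=> a b Ya Yb nab; case: (tot _ _ nab) => h; first exact: main.
by case: (main b a Yb Ya h); [right|left].
Qed.

End CyclicOrders.

Definition ord_lt n (i j : 'I_n) : Prop := (i < j)%N.

Lemma ord_lt_linear n : strict_linear (@ord_lt n).
Proof.
split=> [a|a b d|a b nab]; rewrite /ord_lt; [by rewrite ltnn|exact: ltn_trans|].
case: (ltngtP a b) => h; [by left|by right|].
by case: nab; apply: val_inj.
Qed.

Lemma strict_linear_exists (T : Type) :
  exists lt : T -> T -> Prop, strict_linear lt.
Proof.
have [R wo] := well_ordering_principle {classic T}.
have min2 a b : R a b \/ R b a.
  have [|z [[]]] := wo (mem [:: a; b]); first by exists a; exact: mem_head.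
  rewrite !inE => /orP[] /eqP -> lb _; [left|right]; apply: lb;
    by rewrite !inE eqxx ?orbT.
have refl a : R a a by case: (min2 a a).
have anti a b : R a b -> R b a -> a = b.
  move=> ab ba; have [|z [_ uz]] := wo (mem [:: a; b]).
    by exists a; exact: mem_head.
  rewrite -(uz a) ?(uz b)//; split; rewrite ?inE ?eqxx ?orbT//.
    by move=> x; rewrite !inE => /orP[] /eqP ->.
  by move=> x; rewrite !inE => /orP[] /eqP ->.
exists (fun a b => R a b /\ a <> b); split.
- by move=> a [].
- move=> a b d [ab nab] [bd nbd].
  (* transitivity: the least element of the three can only be [a] *)
  have nad : a <> d by move=> e; subst d; apply: nab; exact: anti.
  split=> //; have [|z [[]]] := wo (mem ([:: a; b; d] : seq {classic T})).
    by exists a; exact: mem_head.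
  rewrite !inE => /or3P[] /eqP -> lb _.
  + by apply: lb; rewrite !inE eqxx !orbT.
  + by case: nab; apply: anti => //; apply: lb; rewrite !inE eqxx.
  + by case: nbd; apply: anti => //; apply: lb; rewrite !inE eqxx orbT.
- by move=> a b nab; case: (min2 a b) => h; [left|right]; split=> // /esym.
Qed.

Lemma strict_linear_flip (T : Type) (lt : T -> T -> Prop) :
  strict_linear lt -> strict_linear (fun a b => lt b a).
Proof.
move=> [irr tr tot]; split=> [//|a b d ba db|a b ab]; first exact: tr db ba.
by case: (tot _ _ ab); [right|left].
Qed.

(** Two consecutive colours form an interval because nothing lies strictly
    between them; the colour 0 takes its successor, any other colour its
    predecessor. *)
Lemma ord_neighbour n (i : 'I_n) : (1 < n)%N -> exists2 j : 'I_n, j <> i &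
  cyc_interval (cyclic_closure (@ord_lt n)) [set x | x = i \/ x = j].
Proof.
move=> n1; have adj (a b : 'I_n) : val b = (val a).+1 ->
    cyc_interval (cyclic_closure (@ord_lt n)) [set x | x = a \/ x = b].
  move=> ab x z /= xab zab nxz.
  have hx : x = a /\ z = b \/ x = b /\ z = a.
    by case: xab zab nxz => -> [] -> // _; [left|right].
  have none y : ~ cyclic_closure (@ord_lt n) a y b.
    by move: ab; rewrite /cyclic_closure /ord_lt /= => ab [] []; lia.
  by case: hx => -[-> ->]; [left|right] => y /none.
case: (posnP i) => [i0|ipos].
  exists (Ordinal n1); first by move=> e; move: i0; rewrite -e.
  by apply: adj; rewrite /= i0.
have ip : (i.-1 < n)%N by have := ltn_ord i; lia.
exists (Ordinal ip); first by move=> /(congr1 (@nat_of_ord n)) /=; lia.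
have := adj (Ordinal ip) i; rewrite /= prednK // => /(_ erefl).
by congr cyc_interval; apply/seteqP; split=> x /=; tauto.
Qed.

(** * Uncrossing *)

Section Uncrossing.
Variables (E : connectivity_system) (a : int) (A B C D : set E).
Hypotheses (UE : A `|` B = C) (IE : A `&` B = D).

(* Every value is an integer or infinite; after that case split the
   inequalities are linear integer arithmetic. *)
Ltac by_submodularity :=
  have := conn_submod A B; rewrite UE IE;
  case: (conn A) (conn B) (conn C) (conn D)
    => [x| |] [y| |] [z| |] [t| |] //=;
  rewrite ?leey ?leNye -?EFinD ?lee_fin //; lia.

Lemma uncross_setU : (conn A <= a%:E)%E -> (conn B <= a%:E)%E ->
  (a%:E <= conn D)%E -> (conn C <= a%:E)%E.
Proof. by_submodularity. Qed.

Lemma uncross_setI : (conn A <= a%:E)%E -> (conn B <= a%:E)%E ->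
  (a%:E <= conn C)%E -> (conn D <= a%:E)%E.
Proof. by_submodularity. Qed.

Lemma uncross_lower : (a%:E <= conn C)%E -> (a%:E <= conn D)%E ->
  (conn B <= a%:E)%E -> (a%:E <= conn A)%E.
Proof. by_submodularity. Qed.

(** If the union has order above [a] while [B] has not, then passing from the
    intersection to [A] strictly raises the order. *)
Lemma uncross_step b : (conn B <= a%:E)%E -> ~ (conn C <= a%:E)%E ->
  (b%:E <= conn D)%E -> ((b + 1)%:E <= conn A)%E.
Proof. by_submodularity. Qed.

End Uncrossing.

(** * The field of good sets *)

Section Anemone.
Variables (E : connectivity_system) (m : int) (n : nat) (c : E -> 'I_n).
Hypothesis connT : (conn [set: E] <= m%:E)%E.
Hypothesis connP : forall J : set 'I_n, J !=set0 -> ~` J !=set0 ->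
  conn (c @^-1` J) = m%:E.
Hypotheses (n4 : (4 <= n)%N) (mn : m + 2 <= n%:Z).

Implicit Types (A B X : set E) (J : set 'I_n).

Let connP_le J : (conn (c @^-1` J) <= m%:E)%E.
Proof.
have [->|/set0P J0] := eqVneq J set0.
  by rewrite conn_setC preimage_set0 setC0.
have [JT|/set0P JT] := eqVneq (~` J) set0; last by rewrite connP.
by rewrite -(setCK J) JT setC0 preimage_setT.
Qed.

Let connP_ge J j l : J j -> ~ J l -> (m%:E <= conn (c @^-1` J))%E.
Proof. by move=> Jj Jl; rewrite connP//; [exists j|exists l]. Qed.

Lemma fourth_colour (i j l : 'I_n) : exists x : 'I_n, [/\ x <> i, x <> j & x <> l].
Proof.
have : (#|[set i; j; l]%SET| < #|'I_n|)%N.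
  rewrite card_ord; apply: leq_trans n4; rewrite ltnS.
  by rewrite (leq_trans (leq_card_setU _ _))// cards1 addn1 ltnS cards2; case: eqP.
move=> h; have /set0Pn[x] : ~: [set i; j; l]%SET != finset.set0.
  by rewrite -card_gt0 cardsCs finset.setCK subn_gt0.
by rewrite !inE !negb_or => /andP[/andP[/eqP ? /eqP ?] /eqP ?]; exists x.
Qed.

(** [c @^-1` [set j]] is the intersection of [X `|` c @^-1` [set j]] with
    [c @^-1` J], and its order is not below [m]. *)
Let spread_up X i j J : X `<=` c @^-1` [set i] -> ~ J i -> J j ->
  (conn (X `|` c @^-1` [set j]) <= m%:E)%E ->
  (conn (X `|` c @^-1` J) <= m%:E)%E.
Proof.
move=> Xi Ji Jj Xj; have ij : i <> j by move=> e; apply: Ji; rewrite e.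
apply: (@uncross_setU _ _ _ (c @^-1` J) _ (c @^-1` [set j]) _ _ Xj) => //.
- apply/seteqP; split=> e /=; first by case=> [[]|] h; [left|right; rewrite h|right].
  by case; [left; left|right].
- apply/seteqP; split=> e /=; last by move=> ->; split=> //; right.
  by case=> -[/Xi /= -> //|].
- by apply: (@connP_ge _ j i).
Qed.

(** [X `|` c @^-1` J] is the intersection of [X `|` c @^-1` J'] with the union
    of classes given by [i |` J]; the colour [l] keeps the union of these two
    sets from being everything, so that its order is exactly [m]. *)
Let spread_down X i l J J' : X `<=` c @^-1` [set i] -> ~ J' i ->
  J `<=` J' -> l <> i -> ~ J' l ->
  (conn (X `|` c @^-1` J') <= m%:E)%E ->
  (conn (X `|` c @^-1` J) <= m%:E)%E.
Proof.
move=> Xi J'i JJ' li J'l XJ'.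
apply: (@uncross_setI _ _ _ (c @^-1` (i |` J)) (c @^-1` (i |` J')) _ _ _ XJ') => //.
- apply/seteqP; split=> e /=.
    by case=> [[/Xi|]|[]]; [left|right|left|right; apply: JJ'].
  by case=> h; [right; left|left; right].
- apply/seteqP; split=> e /=; last by case=> [h|h]; split; [left|left; exact: Xi|right; exact: JJ'|right].
  by case=> -[h|h] [h'|h']; [left|left|case: J'i; rewrite -h'|right].
- by apply: (@connP_ge _ i l) => /=; [left|case].
Qed.

(** The bound passes from a single colour to every larger [J] and, as long as a
    colour other than [i] is left out, from a set of colours to its subsets.  So
    one can go from [j] up to [j] and [l], down to [l] alone, and up to any [J]
    containing [l]; a fourth colour is what permits the step down. *)
Lemma subpetal_spread X i j J : X `<=` c @^-1` [set i] -> i <> j ->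
  (conn (X `|` c @^-1` [set j]) <= m%:E)%E -> ~ J i ->
  (conn (X `|` c @^-1` J) <= m%:E)%E.
Proof.
move=> Xi ij Xj Ji; have [->|/set0P[l Jl]] := eqVneq J set0.
  have [x [xi xj _]] := fourth_colour i j j.
  by apply: (@spread_down _ i x _ [set j]) Xj => //.
have li : l <> i by move=> e; apply: Ji; rewrite -e.
apply: (@spread_up _ i l) => //.
have [x [xi xj xl]] := fourth_colour i j l.
apply: (@spread_down _ i x _ [set j; l]) => //=.
- by case=> // e; case: li.
- by case=> e; [apply: xj|apply: xl].
- apply: (@spread_up _ i j) => //=; last by left.
  by case=> // e; case: li.
Qed.

Lemma subpetal_lower X i j : X `<=` c @^-1` [set i] -> i <> j ->
  (m%:E <= conn (X `|` c @^-1` [set j]))%E.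
Proof.
move=> Xi ij; rewrite leNgt; apply/negP => lt_m.
(* Otherwise the bound [m] also holds with [l] in place of [j]; uncrossing with
   the complement of [X `|` c @^-1` [set l]] then contradicts [lt_m]. *)
have [l [li lj _]] := fourth_colour i j j.
have Xl : (conn (X `|` c @^-1` [set l]) <= m%:E)%E.
  by apply: (subpetal_spread Xi ij (ltW lt_m)) => /= e; apply: li.
move: lt_m; apply/negP; rewrite -leNgt.
have /= := @uncross_lower E m (X `|` c @^-1` [set j]) (~` (X `|` c @^-1` [set l]))
  (c @^-1` (~` [set l])) (c @^-1` [set j]).
rewrite -conn_setC; apply => //.
- apply/seteqP; split=> e /=.
    case=> [[/Xi /= ->|->]|h] // => [el|el|el]; [by apply: li|by apply: lj|].
    by apply: h; right.
  move=> cel; have [ce|ce] := pselect (c e = i); last by right=> -[/Xi|].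
  by have [Xe|Xe] := pselect (X e); [left; left|right=> -[]].
- apply/seteqP; split=> e /=; first by case=> -[Xe|//] []; left.
  move=> ce; split; [by right|case=> [/Xi /=|]]; rewrite ce => e'; first by apply: ij.
  by apply: lj.
- by apply: (@connP_ge _ j l) => /= [e|]; [apply: lj|apply].
- by apply: (@connP_ge _ j i).
Qed.

(** Quantifying over all [J], the empty one included, makes closure under
    complements immediate and lets [J] absorb limits; [goodP] shows that one
    colour per class suffices. *)
Definition good A : Prop := forall i J, ~ J i ->
  (conn ((A `&` c @^-1` [set i]) `|` c @^-1` J) <= m%:E)%E.

Lemma goodP A : (forall i, exists2 j, i <> j &
  (conn ((A `&` c @^-1` [set i]) `|` c @^-1` [set j]) <= m%:E)%E) -> good A.
Proof.
move=> h i J Ji; have [j ij hj] := h i.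
exact: (subpetal_spread (@subIsetr _ _ _) ij hj).
Qed.

Lemma goodC A : good A -> good (~` A).
Proof.
move=> gA i J Ji; rewrite conn_setC.
rewrite (_ : ~` _ = (A `&` c @^-1` [set i]) `|` c @^-1` (~` (i |` J))).
  by apply: gA => /=; apply; left.
apply/seteqP; split=> e /=.
  move=> /not_orP[/not_andP h hJ].
  have [ce|ce] := pselect (c e = i); last by right; case.
  by left; split=> //; case: h => [/contrapT|//].
case=> [[Ae ce]|h]; first by case=> [[]//|]; rewrite ce.
by apply: contra_not h => -[[_ ->]|]; [left|right].
Qed.

(** In each class, joined with another class, the two traces are uncrossed: the
    intersection has order at least [m] by [subpetal_lower], which leaves at
    most [m] for the union. *)
Lemma goodU A B : good A -> good B -> good (A `|` B).
Proof.
move=> gA gB; apply: goodP => i; have [j [ji _ _]] := fourth_colour i i i.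
have ij : i <> j by move=> e; apply: ji.
exists j => //.
apply: (@uncross_setU _ _ ((A `&` c @^-1` [set i]) `|` c @^-1` [set j])
  ((B `&` c @^-1` [set i]) `|` c @^-1` [set j]) _
  (((A `&` B) `&` c @^-1` [set i]) `|` c @^-1` [set j])).
- by rewrite setIUl setUACA setUid.
- by rewrite -setUIl setIACA setIid.
- exact: gA.
- exact: gB.
- exact: subpetal_lower (@subIsetr _ _ _) ij.
Qed.

(** Limit closure is an axiom about natural bounds. *)
Lemma m_nat : exists p : nat, m = p%:Z.
Proof.
have := conn_ge0 [set: E] => h; have := le_trans h connT; rewrite lee_fin => m0.
by exists `|m|%N; rewrite gez0_abs.
Qed.

Lemma good_chain (C : set (set E)) : C `<=` good -> total_on C subset ->
  good (\bigcup_(A in C) A).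
Proof.
move=> Cg Ct i J Ji.
have [->|/set0P[A0 CA0]] := eqVneq C set0.
  by rewrite bigcup_set0 set0I set0U.
have [p mp] := m_nat.
pose g (A : set E) := (A `&` c @^-1` [set i]) `|` c @^-1` J.
have -> : ((\bigcup_(A in C) A) `&` c @^-1` [set i]) `|` c @^-1` J =
    \bigcup_(A in g @` C) A.
  apply/seteqP; split=> e /=.
    case=> [[[A CA Ae] ce]|Je]; first by exists (g A); [exists A|left].
    by exists (g A0); [exists A0|right].
  case=> _ [A CA <-] [[Ae ce]|Je]; [left; split=> //; by exists A|by right].
rewrite mp; apply: conn_limit_closed.
- by exists (g A0); exists A0.
- move=> _ _ [A CA <-] [B CB <-].
  by case: (Ct A B CA CB) => AB; [left|right]; apply: setSU; apply: setSI.
- by move=> _ [A CA <-]; rewrite -mp; apply: Cg.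
Qed.

(** A maximal good subset of the union must absorb every member of [F], by
    closure under binary unions. *)
Lemma good_bigcup (F : set (set E)) : F `<=` good -> good (\bigcup_(A in F) A).
Proof.
move=> Fg.
have [|A [[gA AF] maxA]] := @Zorn_bigcup _
    [set A | good A /\ A `<=` \bigcup_(B in F) B].
  move=> C CP Ct; split; first by apply: good_chain => // A /CP[].
  by move=> e [A /CP[_ AF] Ae]; exact: AF.
suff -> : \bigcup_(B in F) B = A by [].
apply/seteqP; split=> // e [B FB Be]; apply: contrapT => Ae.
apply: (maxA (A `|` B)); last first.
  split; first by apply: goodU => //; exact: Fg.
  by move=> x [/AF//|Bx]; exists B.
split; first exact: subsetUl.
by move=> /(_ e); apply: contra_not Ae; apply; right.
Qed.

(** The classes are added one at a time.  The set built so far and the trace of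
    [A] on the next class, joined with the class [j], meet exactly in that class
    [j], whose order is [m]: keeping it whole supplies the lower bound that
    uncrossing needs. *)
Lemma good_add A j s : good A -> (s <= n)%N ->
  (conn ((A `&` c @^-1` [set x : 'I_n | (x < s)%N]) `|` c @^-1` [set j]) <= m%:E)%E.
Proof.
move=> gA; elim: s => [|s IH] sn.
  rewrite (_ : _ `&` _ = set0) ?set0U; first exact: connP_le.
  by apply/seteqP; split=> e //= [].
have {}IH := IH (ltnW sn); pose i := Ordinal sn.
have [sj|/eqP ij] := eqVneq i j.
  rewrite (_ : _ `|` _ = (A `&` c @^-1` [set x : 'I_n | (x < s)%N]) `|` c @^-1` [set j]) //.
  apply/seteqP; split=> e /=; last by case=> [[Ae h]|]; [left; split=> //; exact: ltnW|right].
  case=> [[Ae]|]; last by right.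
  rewrite ltnS leq_eqVlt => /orP[/eqP h|]; last by left.
  by right; rewrite -sj; apply: val_inj.
apply: (uncross_setU _ _ IH (gA i [set j] _)) => //.
- apply/seteqP; split=> e /=.
    case=> [[[Ae h]|]|[[Ae ->]|]]; [left; split=> //; exact: ltnW|by right|by left|by right].
  case=> [[Ae]|]; last by left; right.
  rewrite ltnS leq_eqVlt => /orP[/eqP h|]; last by left; left.
  by right; left; split=> //; apply: val_inj.
- have -> // : ((A `&` c @^-1` [set x : 'I_n | (x < s)%N]) `|` c @^-1` [set j])
    `&` ((A `&` c @^-1` [set i]) `|` c @^-1` [set j]) = c @^-1` [set j].
  rewrite -setUIl setIACA setIid -preimage_setI (_ : _ `&` [set i] = set0).
    by rewrite preimage_set0 setI0 set0U.
  by apply/seteqP; split=> e //= [] /[swap] ->; rewrite ltnn.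
- exact: (@connP_ge _ j i).
Qed.

Lemma good_conn_setD A j : good A -> (conn (A `\` c @^-1` [set j]) <= m%:E)%E.
Proof.
move=> gA; have := good_add j (goodC gA) (leqnn n).
rewrite conn_setC setCU setCI setCK (_ : _ @^-1` _ = setT) ?setCT ?setU0//.
by apply/seteqP; split=> e //= _; exact: ltn_ord.
Qed.

(** The traces [pre s] of [A] on the first [s] classes satisfy
    [pre s = pre s.+1 `&` (A `\` class s)], and the union of these two sets is
    [A].  If [A] had order above [m], each step would raise the order by at least
    one, so [pre n.-1], which is [A] without its last class, would have order at
    least [n.-1], hence above [m]. *)
Lemma good_conn A : good A -> (conn A <= m%:E)%E.
Proof.
move=> gA; apply: contrapT => Am.
pose pre s := A `&` c @^-1` [set x : 'I_n | (x < s)%N].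
have grow s : (s <= n)%N -> (s%:Z%:E <= conn (pre s))%E.
  elim: s => [|s IH] sn; first exact: conn_ge0.
  pose i := Ordinal sn.
  rewrite (_ : s.+1%:Z = s%:Z + 1); last by lia.
  apply: (uncross_step (B := A `\` c @^-1` [set i]) (C := A) (D := pre s) _ _
    (good_conn_setD i gA) Am (IH (ltnW sn))).
  - apply/seteqP; split=> e /=; first by case=> -[].
    move=> Ae; have [ce|ce] := pselect (c e = i); last by right.
    by left; split=> //=; rewrite ce /=.
  - apply/seteqP; split=> e; rewrite /pre /=.
      case=> -[Ae ce] [_ ci]; split=> //; rewrite ltn_neqAle -ltnS ce andbT.
      by apply/eqP => es; apply: ci; apply: val_inj.
    case=> Ae h; do !split=> //; first exact: ltnW.
    by move=> ce; move: h; rewrite ce ltnn.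
have n0 : (n.-1 < n)%N by lia.
have := le_trans (grow _ (ltnW n0)) (_ : _ <= m%:E)%E.
rewrite lee_fin; suff h : (conn (pre n.-1) <= m%:E)%E by move=> /(_ h); lia.
rewrite (_ : pre _ = A `\` c @^-1` [set Ordinal n0]); first exact: good_conn_setD.
apply/seteqP; split=> e; rewrite /pre /=.
  by case=> Ae h; split=> // ce; move: h; rewrite ce ltnn.
case=> Ae ce; split=> //; rewrite ltn_neqAle -ltnS prednK ?ltn_ord ?andbT; last by lia.
by apply/eqP => h; apply: ce; apply: val_inj.
Qed.

End Anemone.

(** * Petals of refinements *)

Section PetalsAreGood.
Variables (E : connectivity_system) (k n : nat) (c : E -> 'I_n).
Local Notation m := (k%:Z - 1).
Hypothesis connT : (conn [set: E] <= m%:E)%E.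
Hypothesis connP : forall J : set 'I_n, J !=set0 -> ~` J !=set0 ->
  conn (c @^-1` J) = m%:E.
Hypotheses (n4 : (4 <= n)%N) (c_onto : forall i, exists e, c e = i).
Variables (Psi : pseudoflower E k) (g : petal_index Psi -> 'I_n).
Hypothesis gP : forall z e, petal z e -> c e = g z.
Hypothesis g_interval : forall Y, cyc_interval (cyclic_closure (@ord_lt n)) Y ->
  cyc_interval (@cyc _ _ Psi) (g @^-1` Y).

Let in_petal e : exists z, @petal _ _ Psi z e.
Proof.
have [cov _ _] := petal_partition Psi.
by have : [set: E] e by []; rewrite -cov => -[z _ ze]; exists z.
Qed.

Let g_onto i : exists z, g z = i.
Proof.
have [e ce] := c_onto i; have [z ze] := in_petal e.
by exists z; rewrite -(gP ze).
Qed.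

Let good_within X i j : X `<=` c @^-1` [set i] -> i <> j ->
  (conn (X `|` c @^-1` [set j]) <= m%:E)%E -> good m c X.
Proof.
move=> Xi ij Xj; apply: goodP => // i'.
have [<-|/eqP ii'] := eqVneq i i'; first by exists j => //; rewrite setIidl.
exists i; first by move=> e; apply: ii'.
rewrite (_ : _ `&` _ = set0) ?set0U; first by rewrite connP//; [exists i|exists j => e; apply: ij].
by apply/seteqP; split=> e //= [/Xi /= -> e']; apply: ii'.
Qed.

(** The cyclic order is cut open in a third class [l], so that the class of [q]
    and its neighbour [j] become convex. The class [j] then lies entirely on one
    side of [q], and the half-lines beginning at [q] and just after [q] towards
    that side are used. *)
Lemma petal_good q : good m c (@petal _ _ Psi q).
Proof.
have [j ji iK] : exists2 j, j <> g q &
    cyc_interval (cyclic_closure (@ord_lt n)) [set x | x = g q \/ x = j].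
  by apply: ord_neighbour; exact: leq_trans n4.
have [l [li lj _]] := fourth_colour n4 (g q) j j.
have [o go] := g_onto l; have [l0 gl0] := g_onto j.
have iL : cyc_interval (cyclic_closure (@ord_lt n)) [set j].
  by move=> x z /= -> ->.
have ij : g q <> j by move=> e; apply: ji.
have cR := cyc_order Psi.
(* Stated for an arbitrary linear order so as to be used with the cut order and
   with its reverse, according to the side of [q] on which [j] lies. *)
have main lt : strict_linear lt ->
    (forall Y, convex lt Y -> cyc_interval (@cyc _ _ Psi) Y) ->
    (forall Y, cyc_interval (@cyc _ _ Psi) Y -> ~ Y o -> convex lt Y) ->
    lt q l0 -> good m c (@petal _ _ Psi q).
  move=> [irr tr tot] cvxI Icvx ql0.
  have cvxK : convex lt (g @^-1` [set x | x = g q \/ x = j]).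
    by apply: Icvx; [exact: g_interval|rewrite /= go; case].
  have cvxL : convex lt (g @^-1` [set j]).
    by apply: Icvx; [exact: g_interval|rewrite /= go].
  have Lq z : g z = j -> lt q z.
    move=> gz; have qz : q <> z by move=> e; subst z; exact: ij.
    case: (tot _ _ qz) => // zq; case: ij.
    exact: (cvxL z l0 q).
  have half (H : set (petal_index Psi)) : (forall a b, H a -> lt a b -> H b) ->
      (forall z, lt q z -> H z) ->
      good m c (\bigcup_(z in H `&` g @^-1` [set g q]) petal z).
    move=> Hup Hq; apply: (@good_within _ (g q) j) => //.
      by move=> e [z [_ /= gz] /gP ->].
    rewrite (_ : _ `|` _ =
        \bigcup_(z in H `&` g @^-1` [set x | x = g q \/ x = j]) petal z).
      apply: petal_interval; apply: cvxI => a b z [Ha ga] [Hb gb] az zb.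
      by split; [exact: Hup az|exact: (cvxK a b)].
    apply/seteqP; split=> e.
      case=> [[z [Hz /= gz] ze]|/= ce]; first by exists z => //; split=> //; left.
      have [z ze] := in_petal e; have gz : g z = j by rewrite -(gP ze).
      by exists z => //; split; [exact/Hq/Lq|right].
    case=> z [Hz /= [gz|gz]] ze; first by left; exists z.
    by right; rewrite /= (gP ze).
  pose tail H := \bigcup_(z in H `&` g @^-1` [set g q]) @petal _ _ Psi z.
  have g_ge : good m c (tail [set z | z = q \/ lt q z]).
    apply: half => [a b /= [->|qa] ab|z qz]; right=> //.
    exact: tr qa ab.
  have g_gt : good m c (tail (lt q)).
    by apply: half => [a b qa ab|z //]; exact: tr qa ab.
  suff -> : petal q = ~` (~` tail [set z | z = q \/ lt q z] `|` tail (lt q)).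
    by apply: goodC; apply: goodU => //; exact: goodC.
  have [_ triv _] := petal_partition Psi.
  rewrite setCU setCK; apply/seteqP; split=> e.
    move=> qe; split; first by exists q => //; split=> //; left.
    move=> [z [qz _] ze]; apply: (irr q).
    by rewrite {2}(triv q z) //; exists e.
  case=> -[z [/= [->//|qz] gz] ze] nW; case: nW.
  by exists z.
have nq0 : q <> l0 by move=> e; apply: ij; rewrite e.
have [_ _ tot] := cut_linear cR o.
case: (tot _ _ nq0) => h.
  apply: (main _ (cut_linear cR o)) h; first exact: convex_interval.
  by move=> Y; exact: interval_convex.
apply: (main _ (strict_linear_flip (cut_linear cR o))) h.
  move=> Y cY; apply: (convex_interval cR (o := o)).
  by move=> a b z Ya Yb az zb; exact: (cY b a).
move=> Y iY Yo a b z Ya Yb az zb.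
exact: (interval_convex cR iY Yo Yb Ya zb az).
Qed.

End PetalsAreGood.

(** * Finite concatenations of an anemone *)

(** Pick [n.+1] points [s i], cut the cyclic order at [s ord0], and send [z] to
    the number of other chosen points that are at most [z].  The chosen points
    have pairwise distinct images, so the map is onto without the points having
    to be listed in increasing order. *)
Lemma finite_quotient (I : Type) (R : I -> I -> I -> Prop) n :
  cyclic_order R -> (`I_n.+1 #<= [set: I])%card ->
  exists f : I -> 'I_n.+1, (forall i, exists z, f z = i) /\
    forall Y, cyc_interval (cyclic_closure (@ord_lt n.+1)) Y ->
      cyc_interval R (f @^-1` Y).
Proof.
move=> cR /card_leP[s0].
pose s (i : 'I_n.+1) : I := val (s0 (SigSub (mem_set (ltn_ord i : `I_n.+1 (val i))))).
have s_inj : injective s.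
  move=> i j /val_inj /(@inj _ _ _ s0).
  by rewrite !in_setT => /(_ isT isT) /(congr1 val) /= /val_inj.
pose o := s ord0; have [irr tr tot] := cut_linear cR o.
pose below z := [set i : 'I_n | `[< ~ cut R o z (s (lift ord0 i)) >]]%SET.
have below_card z : (#|below z| < n.+1)%N.
  by rewrite ltnS (leq_trans (max_card _))// card_ord.
pose f z : 'I_n.+1 := Ordinal (below_card z).
have sub a b : cut R o a b -> below a \subset below b.
  move=> ab; apply/fintype.subsetP => i; rewrite !finset.inE => /asboolP h.
  by apply/asboolP => bi; apply: h; exact: tr ab bi.
have omin z : z <> o -> cut R o o z by left.
have strict i j : cut R o (s i) (s j) -> (f (s i) < f (s j))%N.
  move=> ij; apply: proper_card; apply/properP; split; first exact: sub.
  have [j' ej|ej] := unliftP ord0 j; last first.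
    case: (irr o); rewrite ej -/o in ij.
    have [so|so] := pselect (s i = o); first by rewrite so in ij.
    exact: tr (omin _ so) ij.
  exists j'; rewrite !finset.inE -ej; first by apply/asboolP; exact: irr.
  by apply/asboolP => h; apply: h.
have fs_inj : injective (f \o s).
  move=> i j /= e; apply/eqP; apply/negPn/negP => /eqP ij.
  have sij : s i <> s j by move=> /s_inj.
  by case: (tot _ _ sij) => /strict; rewrite e ltnn.
exists f; split.
  by move=> i; have [h hK fsK] := injF_bij fs_inj; exists (s (h i)); exact: fsK.
move=> Y; apply: (interval_preimage cR (o := o) (ord_lt_linear n.+1)).
move=> a b /sub /subset_leq_card; rewrite leq_eqVlt => /orP[/eqP h|h]; [left|by right].
exact: val_inj.
Qed.

Section Merge.
Variables (E : connectivity_system) (k : nat) (Phi : pseudoflower E k).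

Lemma petal_locator : exists loc : E -> petal_index Phi,
  forall z e, petal z e <-> loc e = z.
Proof.
have [cov triv _] := petal_partition Phi.
have /choice[loc locP] : forall e, exists z, @petal _ _ Phi z e.
  by move=> e; have : [set: E] e by []; rewrite -cov => -[z _ ze]; exists z.
exists loc => z e; split=> [ze|<- //].
by apply: triv => //; exists e.
Qed.

Variables (n : nat) (f : petal_index Phi -> 'I_n).
Hypothesis f_onto : forall i, exists z, f z = i.
Hypothesis f_interval : forall Y, cyc_interval (cyclic_closure (@ord_lt n)) Y ->
  cyc_interval (@cyc _ _ Phi) (f @^-1` Y).
Variable loc : E -> petal_index Phi.
Hypothesis locP : forall z e, petal z e <-> loc e = z.

Lemma merged_partition : partition setT (fun i => (f \o loc) @^-1` [set i]) setT.
Proof.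
split.
- by apply/seteqP; split=> e // _; exists (f (loc e)).
- by move=> i j _ _ [e [/= <- <-]].
- move=> i _; have [z <-] := f_onto i.
  have [_ _ /(_ z I)[e /locP ez]] := petal_partition Phi.
  by exists e; rewrite /= ez.
Qed.

Lemma merged_interval Y : cyc_interval (cyclic_closure (@ord_lt n)) Y ->
  (conn (\bigcup_(i in Y) (f \o loc) @^-1` [set i]) <= (k%:Z - 1)%:E)%E.
Proof.
move=> /f_interval /petal_interval; congr (conn _ <= _)%E.
apply/seteqP; split=> e.
  by move=> [z Yz /locP ez]; exists (f z); rewrite //= ez.
move=> [i Yi /= ei]; exists (loc e); last exact/locP.
by rewrite /= ei.
Qed.

Definition merge : pseudoflower E k :=
  Pseudoflower (cyclic_closureP (ord_lt_linear n)) merged_partition merged_interval.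

Lemma merge_concatenation : concatenation merge Phi.
Proof. by exists f; split=> // z e /locP /= ->. Qed.

End Merge.

(** A point is coloured by the block of consecutive petals that contains it.  The
    map from the petals of [Psi] to those of [Phi] composed with the map to
    blocks says which colour each petal of [Psi] lies in. *)
Lemma anemone_colouring (E : connectivity_system) (k n : nat)
    (Phi : pseudoflower E k) : anemone Phi -> at_least_petals n.+1 Phi ->
  exists c : E -> 'I_n.+1,
    [/\ forall J : set 'I_n.+1, J !=set0 -> ~` J !=set0 ->
          conn (c @^-1` J) = (k%:Z - 1)%:E,
        forall i, exists e, c e = i
      & forall Psi, concatenation Phi Psi ->
        exists g : petal_index Psi -> 'I_n.+1,
          (forall z e, petal z e -> c e = g z) /\
          forall Y, cyc_interval (cyclic_closure (@ord_lt n.+1)) Y ->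
            cyc_interval (@cyc _ _ Psi) (g @^-1` Y)].
Proof.
move=> [_ ane] hn; have [loc locP] := petal_locator Phi.
have [f [f_onto f_int]] := finite_quotient (cyc_order Phi) hn.
have M := merged_partition f_onto locP.
exists (f \o loc); split.
- move=> J [i Ji] [j Jj].
  have fin : finitely_many_petals (merge f_onto f_int locP) by exact: finite_finset.
  rewrite -(ane _ (merge_concatenation f_onto f_int locP) fin J).
    congr conn; apply/seteqP; split=> e; first by move=> Je; exists (f (loc e)).
    by move=> [l Jl /= el]; rewrite /= el.
  by split=> h; [move: Ji; rewrite h|apply: Jj; rewrite h].
- by move=> i; have [_ _ /(_ i I)[e]] := M; exists e.
- move=> Psi [f' [f'P f'_int]]; exists (f \o f'); split.
    by move=> z e /f'P /locP /= ->.
  by move=> Y /f_int /f'_int.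
Qed.

(** * Atoms of a complete field of sets *)

Section Atoms.
Variables (E : connectivity_system) (k : nat) (G : set (set E)).
Hypothesis G_setC : forall A, G A -> G (~` A).
Hypothesis G_bigcup : forall F, F `<=` G -> G (\bigcup_(A in F) A).
Hypothesis G_conn : forall A, G A -> (conn A <= (k%:Z - 1)%:E)%E.

Let atom e : set E := \bigcap_(A in [set A | G A /\ A e]) A.

Let G_atom e : G (atom e).
Proof.
rewrite /atom -(setCK (\bigcap_(A in _) A)) setC_bigcap; apply: G_setC.
rewrite -(bigcup_image _ setC id); apply: G_bigcup => _ [A [GA _] <-].
exact: G_setC.
Qed.

Let atom_id e : atom e e. Proof. by move=> A []. Qed.

Let atom_eq e e' : atom e e' -> atom e = atom e'.
Proof.
move=> ee'.
have e'e : atom e' e.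
  apply: contrapT => h; have := ee' (~` atom e') (conj (G_setC (G_atom e')) h).
  by apply.
apply/seteqP; split; first exact: (bigcap_inf (conj (G_atom e') e'e)).
exact: (bigcap_inf (conj (G_atom e) ee')).
Qed.

(** Every union of atoms belongs to [G], so the atoms may be arranged in the
    cyclic order coming from an arbitrary linear order. *)
Lemma atomic_pseudoanemone : exists Psi : pseudoflower E k,
  strong_pseudoanemone Psi /\
  forall Psi' : pseudoflower E k, (forall q, G (@petal _ _ Psi' q)) -> leA Psi' Psi.
Proof.
pose I := {X : set E | exists e, X = atom e}; pose P (X : I) := sval X.
have [lt lin] := strict_linear_exists I.
have PG (X : I) : G (P X) by case: X => /= X [e ->].
have part : partition setT P setT.
  split.
  - apply/seteqP; split=> e // _.
    exists (exist _ (atom e) (ex_intro _ e erefl)) => //.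
    exact: (@atom_id e).
  - move=> X0 Y0 _ _; case: X0 Y0 => [X [x Xx]] [Y [y Yy]] [e []].
    rewrite /P /= => Xe Ye.
    by apply: eq_exist; move: Xe Ye; rewrite Xx Yy => /atom_eq -> /atom_eq ->.
  - by move=> [X [e Xe]] _; exists e; rewrite /P /= Xe.
have unionG (Y : set I) : G (\bigcup_(X in Y) P X).
  by rewrite -(bigcup_image Y P id); apply: G_bigcup => _ [X _ <-].
exists (Pseudoflower (cyclic_closureP lin) part (fun Y _ => G_conn (unionG Y))).
split; first by move=> Y; exact/G_conn/unionG.
move=> Psi' Gq [X [e Xe]] /=; have [loc locP] := petal_locator Psi'.
exists (loc e); rewrite /P /= Xe; apply: bigcap_inf; split=> //.
exact/locP.
Qed.

End Atoms.

(** * The strong pseudoanemone above an anemone *)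

Theorem theorem6p5 (E : connectivity_system) (k : nat) (Phi : pseudoflower E k)
    (hPhi : anemone Phi) (hk : at_least_petals k.+1 Phi) :
  exists Psi : pseudoflower E k,
    strong_pseudoanemone Psi /\ leA Phi Psi /\
    forall Psi' : pseudoflower E k, concatenation Phi Psi' -> leA Psi' Psi.
Proof.
(* [n.+1] is the larger of 4 and [k.+1]. *)
have [n [n4 kn hn]] : exists n, [/\ (4 <= n.+1)%N, (k < n.+1)%N &
    at_least_petals n.+1 Phi].
  have [h4 _] := hPhi.1; case: (leqP 4 k.+1) => h; first by exists k.
  by exists 3%N; split=> //; exact: ltn_trans h.
have [c [cP c_onto cg]] := anemone_colouring hPhi hn.
have connT : (conn [set: E] <= (k%:Z - 1)%:E)%E.
  have [cov _ _] := petal_partition Phi; rewrite -cov.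
  by apply: petal_interval => x z _ _ _; left.
have mn : (k%:Z - 1) + 2 <= n.+1%:Z by lia.
have [Psi [strong least]] := atomic_pseudoanemone (@goodC _ _ _ c)
  (@good_bigcup _ _ _ c connT cP n4) (good_conn connT cP n4 mn).
have above Psi' : concatenation Phi Psi' -> leA Psi' Psi.
  move=> /cg[g [gP g_int]]; apply: least => q.
  exact: (petal_good connT cP n4 c_onto gP g_int).
exists Psi; split=> //; split=> //.
apply: above; exists id; split; last by [].
by move=> i; exact: subset_refl.
Qed.
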